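(* Let $G$ be a locally compact Hausdorff group, $\mathcal H$ a complex Hilbert space and $\pi:G\to U(\mathcal H)$ a strongly continuous unitary representation. Then $\pi$ is irreducible if and only if the flip operator $F$ on $\mathcal H\otimes\mathcal H$ belongs to the von Neumann algebra $W^*((\pi\otimes\pi)(G\times G))\subset B(\mathcal H\otimes\mathcal H)$.
   Context: $\mathcal H\otimes\mathcal H$ is the Hilbert tensor product, and the flip (braiding) operator $F:\mathcal H\otimes\mathcal H\to\mathcal H\otimes\mathcal H$ is the unique unitary involution with $F(v\otimes w)=w\otimes v$ for all $v,w\in\mathcal H$. The representation $\pi\otimes\pi:G\times G\to U(\mathcal H\otimes\mathcal H)$ is $(g,h)\mapsto\pi(g)\otimes\pi(h)$. $W^*((\pi\otimes\pi)(G\times G))=(\pi\otimes\pi)(G\times G)''$ is the double commutant, equivalently the closure in the weak operator topology of the linear span of $(\pi\otimes\pi)(G\times G)$. Irreducible means that the only closed $\pi(G)$-invariant subspaces of $\mathcal H$ are $\{0\}$ and $\mathcal H$. *)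

(* Defs.v *)
From HB Require Import structures.
From mathcomp Require Import all_boot all_order all_algebra.
From mathcomp Require Import monoid sesquilinear complex.
From mathcomp Require Import all_classical all_reals all_analysis.

Set Implicit Arguments.
Unset Strict Implicit.
Unset Printing Implicit Defensive.

Import Order.TTheory GRing.Theory Num.Theory Num.Def.
Import numFieldNormedType.Exports.

Local Open Scope classical_set_scope.
Local Open Scope complex_scope.
Local Open Scope ring_scope.

HB.mixin Record isTopologicalGroup G & Group G & Topological G := {
  mulg_continuous : continuous (fun p : G * G => (p.1 * p.2)%g);
  invg_continuous : continuous (fun g : G => (g^-1)%g)
}.

#[short(type="topologicalGroupType")]
HB.structure Definition TopologicalGroup :=
  {G of Group G & Topological G & isTopologicalGroup G}.

(* The inner product is linear in its first argument and conjugate-linear in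
   the second one; it induces the norm, hence the topology. *)
HB.mixin Record NormedModule_hasInner (R : realType) V
    & NormedModule R[i] V := {
  inner : {dot V for (@conjC R[i])};
  innerxx : forall v : V, inner v v = `|v| ^+ 2
}.

#[short(type="hilbertType")]
HB.structure Definition Hilbert (R : realType) :=
  {V of CompleteNormedModule R[i] V & NormedModule_hasInner R V}.

Definition linear_subspace (R : realType) (V : hilbertType R) (W : set V) :=
  submod_closed [in W].

Definition linear_span (R : realType) (V : hilbertType R) (S : set V) : set V :=
  smallest (@linear_subspace R V) S.

Definition bounded_operator (R : realType) (V : hilbertType R) : set (V -> V) :=
  [set A | linear A /\ exists M : R[i], forall v, `|A v| <= M * `|v|].

Definition commutant (R : realType) (V : hilbertType R) (S : set (V -> V)) :
    set (V -> V) :=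
  [set A | bounded_operator A /\ forall B, S B -> A \o B = B \o A].

Definition von_neumann (R : realType) (V : hilbertType R) (S : set (V -> V)) :
    set (V -> V) :=
  commutant (commutant S).

Definition unitary (R : realType) (V : hilbertType R) (U : V -> V) :=
  [/\ linear U, forall x y, inner (U x) (U y) = inner x y
    & forall y, exists x, U x = y].

Record unitary_rep (R : realType) (G : groupType) (V : hilbertType R) :=
  UnitaryRep {
    rep :> G -> V -> V;
    rep_unitary : forall g, unitary (rep g);
    repM : forall g h, rep (g * h)%g = rep g \o rep h
  }.

Definition strongly_continuous (R : realType) (G : topologicalGroupType)
    (V : hilbertType R) (pi : unitary_rep G V) :=
  forall v : V, continuous (fun g : G => pi g v).

Definition irreducible_rep (R : realType) (G : groupType) (V : hilbertType R)
    (pi : unitary_rep G V) :=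
  forall W : set V, closed W -> linear_subspace W ->
    (forall g w, W w -> W (pi g w)) -> W = [set 0] \/ W = [set: V].

(* A Hilbert tensor product of V and W; the fields below determine it up to a
   unique unitary isomorphism compatible with the simple tensors. *)
Record hilbert_tensor (R : realType) (V W : hilbertType R) := HilbertTensor {
  tensor_space :> hilbertType R;
  tensor : {bilinear V -> W -> tensor_space};
  inner_tensor : forall v v' w w',
    inner (tensor v w) (tensor v' w') = inner v v' * inner w w';
  dense_tensor : dense (linear_span (range (fun p => tensor p.1 p.2)))
}.

Section isometric_extension.
Variables (R : realType) (V : hilbertType R) (I : Type).
Implicit Types (a b f : I -> V).

Let comb (f : I -> V) (c : seq (R[i] * I)) := \sum_(p <- c) p.1 *: f p.2.

Let graph (f g : I -> V) (x y : V) := forall e : R[i], 0 < e ->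
  exists2 c, `|x - comb f c| < e & `|y - comb g c| < e.

Lemma combD f c d : comb f (c ++ d) = comb f c + comb f d.
Proof. by rewrite /comb big_cat. Qed.

Lemma combZ f k c : comb f [seq (k * p.1, p.2) | p <- c] = k *: comb f c.
Proof.
by rewrite /comb big_map scaler_sumr; apply: eq_bigr => p _; rewrite scalerA.
Qed.

Lemma linear_span_comb f x : linear_span (range f) x -> exists c, x = comb f c.
Proof.
move=> /(_ [set x | exists c, x = comb f c]); apply; split.
  split; first by rewrite inE; exists [::]; rewrite /comb big_nil.
  move=> k u v; rewrite !inE => -[c ->] [d ->].
  by exists ([seq (k * p.1, p.2) | p <- c] ++ d); rewrite combD combZ.
by move=> _ [i _ <-]; exists [:: (1, i)]; rewrite /comb big_seq1 scale1r.
Qed.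

Lemma comb_approx f : dense (linear_span (range f)) ->
  forall x (e : R[i]), 0 < e -> exists c, `|x - comb f c| < e.
Proof.
move=> fd x e e0.
have [||y [xy /linear_span_comb [c yc]]] := fd (ball x e).
- by exists x; exact: ballxx.
- exact: ball_open.
by exists c; rewrite -yc; move: xy; rewrite -ball_normE.
Qed.

Lemma norm_comb a b : (forall i j, inner (a i) (a j) = inner (b i) (b j)) ->
  forall c, `|comb a c| = `|comb b c|.
Proof.
move=> ab c; apply/eqP; rewrite -(@eqrXn2 _ 2) // -!innerxx; apply/eqP.
rewrite /comb !linear_sumlz /=; apply: eq_bigr => p _.
rewrite !linear_sumr /=; apply: eq_bigr => q _.
by rewrite !linearZl_LR !linearZr_LR /= ab.
Qed.

Section graph_ab.
Variables (a b : I -> V).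
Hypothesis ab : forall i j, inner (a i) (a j) = inner (b i) (b j).

Lemma combB f c d : comb f c - comb f d = comb f (c ++ [seq (-1 * p.1, p.2) | p <- d]).
Proof. by rewrite combD combZ scaleN1r. Qed.

Lemma graph_total : dense (linear_span (range a)) -> forall x, exists y, graph a b x y.
Proof.
move=> ad x.
pose F : set_system V := [set S | exists2 e : R[i], 0 < e &
  forall c, `|x - comb a c| < e -> S (comb b c)].
have FF : ProperFilter F.
  split.
    by move=> [e e0 Fe]; have [c /Fe] := comb_approx ad x e0.
  split.
  - by exists 1.
  - move=> P Q [e e0 Pe] [d d0 Qd]; exists (Num.min e d).
      by rewrite /Num.min; case: ifP.
    have ed : (e >=< d)%O by apply: real_comparable; exact: gtr0_real.
    by move=> c; rewrite comparable_lt_min// => /andP[? ?]; split; [exact: Pe|exact: Qd].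
  - by move=> P Q PQ [e e0 Pe]; exists e => // c /Pe /PQ.
have /cauchy_cvg : cauchy F.
  apply: cauchy_exP => e e0.
  have e20 : 0 < e / 2 by rewrite divr_gt0.
  have [c0 xc0] := comb_approx ad x e20.
  exists (comb b c0); exists (e / 2) => // c xc.
  rewrite -ball_normE /ball_ /= combB -(norm_comb ab) -combB.
  rewrite (le_lt_trans (ler_distD x _ _))// [ltRHS]splitr ltrD//.
  by rewrite distrC.
move=> /cvg_ex [y Fy]; exists y => e e0.
have : F (ball y e) by apply: Fy; exact: nbhsx_ballx.
move=> [d d0 dF].
have ed : (e >=< d)%O by apply: real_comparable; exact: gtr0_real.
have ed0 : 0 < Num.min e d by rewrite /Num.min; case: ifP.
have [c] := comb_approx ad x ed0; rewrite comparable_lt_min// => /andP[xc xd].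
by exists c => //; have := dF _ xd; rewrite -ball_normE.
Qed.

Lemma graph_linear k x y x' y' : graph a b x y -> graph a b x' y' ->
  graph a b (k *: x + x') (k *: y + y').
Proof.
move=> xy xy' e e0.
have k0 : 0 < `|k| + 1 by rewrite ltr_wpDl.
have d0 : 0 < e / 2 / (`|k| + 1) by rewrite !divr_gt0.
have e20 : 0 < e / 2 by rewrite divr_gt0.
have [c xc yc] := xy _ d0; have [c' xc' yc'] := xy' _ e20.
have H z z' w w' : `|z - w| < e / 2 / (`|k| + 1) -> `|z' - w'| < e / 2 ->
    `|k *: z + z' - (k *: w + w')| < e.
  move=> zw zw'; rewrite opprD addrACA -scalerBr.
  rewrite (le_lt_trans (ler_normD _ _))// [ltRHS]splitr ltr_leD//; last exact: ltW.
  rewrite normrZ; apply: (@le_lt_trans _ _ ((`|k| + 1) * `|z - w|)).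
    by rewrite ler_wpM2r// lerDl.
  by rewrite mulrC -ltr_pdivlMr.
exists ([seq (k * p.1, p.2) | p <- c] ++ c'); rewrite combD combZ; exact: H.
Qed.

Lemma graph_norm x y : graph a b x y -> `|x| = `|y|.
Proof.
move=> xy.
have H z w (f g : I -> V) : (forall c, `|comb f c| = `|comb g c|) ->
    graph f g z w -> `|z| <= `|w|.
  move=> fg zw; apply/ler_addgt0Pr => e e0.
  have e20 : 0 < e / 2 by rewrite divr_gt0.
  have [c zc wc] := zw _ e20.
  rewrite -[z](subrK (comb f c)) (le_trans (ler_normD _ _))// fg.
  rewrite -[comb g c](subrK w) (le_trans (lerD (ltW zc) (ler_normD _ _)))//.
  rewrite distrC addrA [leRHS]addrC lerD2r [leRHS]splitr lerD2l; exact: ltW.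
apply/le_anti/andP; split; first exact: (H _ _ a b (norm_comb ab)).
apply: (H _ _ b a); first by move=> c; rewrite (norm_comb ab).
by move=> e /xy[c ? ?]; exists c.
Qed.

Lemma graph_fun x y y' : graph a b x y -> graph a b x y' -> y = y'.
Proof.
move=> xy xy'; have := graph_norm (graph_linear (-1) xy' xy).
rewrite !scaleN1r ![- _ + _]addrC subrr normr0 => /esym/normr0_eq0/eqP.
by rewrite subr_eq0 => /eqP.
Qed.

End graph_ab.

Lemma isometryP (U : V -> V) : linear U -> (forall x, `|U x| = `|x|) ->
  forall x y, inner (U x) (U y) = inner x y.
Proof.
move=> lU nU x y.
have UD u v : U (u + v) = U u + U v by rewrite -[u]scale1r lU !scale1r.
have U0 : U 0 = 0 by apply/normr0_eq0; rewrite nU normr0.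
have UZ k u : U (k *: u) = k *: U u by rewrite -[k *: u]addr0 lU U0 addr0.
have re u v : inner (U u) (U v) + (inner (U u) (U v))^* = inner u v + (inner u v)^*.
  have := innerxx (U (u + v)); rewrite nU -innerxx UD !dnormD !innerxx !nU.
  exact: addrI.
have := re x y; have := re ('i *: x) y.
rewrite UZ !linearZl_LR /= !rmorphM /= conjCi !mulNr -!mulrBr.
move=> /(mulfI (neq0Ci _)) im {}re.
have E (u v : R[i]) : u + v + (u - v) = u *+ 2.
  by rewrite addrACA subrr addr0 mulr2n.
have := congr2 +%R re im; rewrite !E => /eqP.
by rewrite eqr_pMn2r// => /eqP.
Qed.

Lemma unitary_extension (a b : I -> V) :
  (forall i j, inner (a i) (a j) = inner (b i) (b j)) ->
  dense (linear_span (range a)) -> dense (linear_span (range b)) ->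
  exists! U : V -> V, unitary U /\ forall i, U (a i) = b i.
Proof.
move=> ab ad bd; have [U gU] := choice (graph_total ab ad).
have lU : linear U.
  move=> k u v; apply: (graph_fun ab (gU _)); exact: graph_linear.
exists U; split; last first.
  move=> U' [[lU' iU' _] U'E]; apply/funext => x.
  apply: (graph_fun ab (gU x)) => e e0; have [c xc] := comb_approx ad x e0.
  have UD u v : U' (u + v) = U' u + U' v.
    by rewrite -[u]scale1r lU' !scale1r.
  have U0 : U' 0 = 0 by apply: (addrI (U' 0)); rewrite -UD !addr0.
  have UZ k u : U' (k *: u) = k *: U' u by rewrite -[k *: u]addr0 lU' U0 addr0.
  exists c => //; suff -> : comb b c = U' (comb a c).
    rewrite -scaleN1r -UZ -UD scaleN1r.
    suff -> v : `|U' v| = `|v| by [].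
    by apply/eqP; rewrite -(@eqrXn2 _ 2) // -!innerxx iU'.
  rewrite /comb; elim: c {xc} => [|p c IH]; first by rewrite !big_nil U0.
  by rewrite !big_cons UD UZ U'E IH.
split; last first.
  move=> i; apply: (graph_fun ab (gU _)) => e e0.
  by exists [:: (1, i)]; rewrite /comb big_seq1 scale1r subrr normr0.
split=> //.
  by apply: isometryP => // x; rewrite (graph_norm ab (gU x)).
move=> y; have [x gx] := graph_total (fun i j => esym (ab i j)) bd y.
exists x; apply: (graph_fun ab (gU _)) => e /gx[c ? ?]; by exists c.
Qed.

End isometric_extension.

Section tensor_operators.
Variables (R : realType) (V W : hilbertType R).

Lemma tensor_unitary_exists (T : hilbert_tensor V W) (A : V -> V) (B : W -> W) :
  unitary A -> unitary B ->
  exists! U : T -> T, unitary U /\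
    forall v w, U (tensor T v w) = tensor T (A v) (B w).
Proof.
move=> [lA iA sA] [lB iB sB].
have [|||U [[uU UE] U_uniq]] := @unitary_extension R T (V * W)%type
  (fun p => tensor T p.1 p.2) (fun p => tensor T (A p.1) (B p.2)).
- by move=> p q; rewrite !inner_tensor iA iB.
- exact: dense_tensor.
- suff -> : range (fun p : V * W => tensor T (A p.1) (B p.2)) =
            range (fun p : V * W => tensor T p.1 p.2) by exact: dense_tensor.
  apply/seteqP; split=> _ [[v w] _ <-] /=; first by exists (A v, B w).
  by have [v' <-] := sA v; have [w' <-] := sB w; exists (v', w').
- exists U; split; first by split => // v w; rewrite (UE (v, w)).
  by move=> U' [uU' U'E]; apply: U_uniq; split => // -[v w]; exact: U'E.
Qed.

Lemma flip_exists (T : hilbert_tensor V V) :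
  exists! F : T -> T, unitary F /\
    forall v w, F (tensor T v w) = tensor T w v.
Proof.
have [|||F [[uF FE] F_uniq]] := @unitary_extension R T (V * V)%type
  (fun p => tensor T p.1 p.2) (fun p => tensor T p.2 p.1).
- by move=> p q; rewrite !inner_tensor mulrC.
- exact: dense_tensor.
- suff -> : range (fun p : V * V => tensor T p.2 p.1) =
            range (fun p : V * V => tensor T p.1 p.2) by exact: dense_tensor.
  by apply/seteqP; split=> _ [[v w] _ <-] /=; exists (w, v).
- exists F; split; first by split => // v w; rewrite (FE (v, w)).
  by move=> F' [uF' F'E]; apply: F_uniq; split => // -[v w]; exact: F'E.
Qed.

End tensor_operators.

Definition tensor_unitary (R : realType) (V W : hilbertType R)
    (T : hilbert_tensor V W) (A : V -> V) (B : W -> W)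
    (uA : unitary A) (uB : unitary B) : T -> T :=
  sval (cid (tensor_unitary_exists T uA uB)).
Arguments tensor_unitary {R V W} T {A B} uA uB _.

Definition flip (R : realType) (V : hilbertType R) (T : hilbert_tensor V V) :
    T -> T :=
  sval (cid (flip_exists T)).
Arguments flip {R V} T _.

Definition tensor_rep (R : realType) (G : groupType) (V : hilbertType R)
    (T : hilbert_tensor V V) (pi : unitary_rep G V) (gh : G * G) : T -> T :=
  tensor_unitary T (rep_unitary pi gh.1) (rep_unitary pi gh.2).
Arguments tensor_rep {R G V} T pi gh _.

Lemma tensor_unitaryP (R : realType) (V W : hilbertType R)
    (T : hilbert_tensor V W) (A : V -> V) (B : W -> W)
    (uA : unitary A) (uB : unitary B) :
  unitary (tensor_unitary T uA uB) /\
  forall v w, tensor_unitary T uA uB (tensor T v w) = tensor T (A v) (B w).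
Proof. by rewrite /tensor_unitary; case: cid => U []. Qed.

Lemma flipP (R : realType) (V : hilbertType R) (T : hilbert_tensor V V) :
  [/\ unitary (flip T), involutive (flip T)
    & forall v w, flip T (tensor T v w) = tensor T w v].
Proof.
rewrite /flip; case: cid => F [[uF FE] _] /=; split => // x.
have uid (X : hilbertType R) : unitary (@idfun X).
  by split => // y; exists y.
have [U [_ U_uniq]] := tensor_unitary_exists T (uid V) (uid V).
have [lF iF sF] := uF.
suff E : F \o F = idfun by exact: (congr1 (@^~ x) E).
rewrite -(U_uniq idfun) ?(U_uniq (F \o F)) //; split=> [|v w /=].
  split=> [k u v /=|u v /=|y]; [by rewrite !lF|by rewrite !iF|].
  by have [y' <-] := sF y; have [x' <-] := sF y'; exists x'.
by rewrite !FE.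
Qed.

(* Main.v *)
Require Import Defs.
From mathcomp Require Import all_boot all_order all_algebra.
From mathcomp Require Import monoid sesquilinear complex.
From mathcomp Require Import all_classical all_reals all_analysis.
From mathcomp Require Import ring.

Local Open Scope classical_set_scope.

Set Implicit Arguments.
Unset Strict Implicit.
Unset Printing Implicit Defensive.

Import Order.TTheory GRing.Theory Num.Theory Num.Def.
Import numFieldNormedType.Exports.

Local Open Scope complex_scope.
Local Open Scope ring_scope.

(** If [pi] is irreducible and [A] commutes with every [pi g (x) pi h], then for
    fixed [w], [w'] the form [(v, v') |-> <A (v (x) w), v' (x) w'>] is given by a
    bounded operator commuting with [pi], hence by Schur's lemma is a multiple of
    [<v, v'>].  The same holds in the other factor (conjugate [A] by the flip), so
    [A] is a scalar, and the flip commutes with it.  Conversely, if [W] is a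
    closed invariant subspace with orthogonal reflection [U], then [U (x) 1] lies
    in the commutant; comparing [F (U (x) 1)] and [(U (x) 1) F] on [v (x) w] with
    [v] in [W] and [w] orthogonal to [W] gives [v (x) w = 0].

    Schur's lemma avoids the spectral theorem: for a self-adjoint contraction [D]
    commuting with [pi], a square root [S] of [D ^+ 2] obtained by iteration
    satisfies [S = D] or [S = - D] by irreducibility, and this forces [D = 0] as
    soon as [<D v0, v0> = 0] for some nonzero [v0]. *)

(** * Elementary algebra of linear maps given as bare functions *)

Section linear_maps.
Variables (K : pzRingType) (U V : lmodType K) (f : U -> V).
Hypothesis lf : linear f.

Lemma linear_funD u v : f (u + v) = f u + f v.
Proof. by rewrite -[u]scale1r lf !scale1r. Qed.

Lemma linear_fun0 : f 0 = 0.
Proof. by apply: (addrI (f 0)); rewrite -linear_funD !addr0. Qed.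

Lemma linear_funZ k u : f (k *: u) = k *: f u.
Proof. by rewrite -[k *: u]addr0 lf linear_fun0 addr0. Qed.

Lemma linear_funN u : f (- u) = - f u.
Proof. by rewrite -!scaleN1r linear_funZ. Qed.

Lemma linear_funB u v : f (u - v) = f u - f v.
Proof. by rewrite linear_funD linear_funN. Qed.

End linear_maps.

(** * Inner product geometry, closed subspaces and bounded maps *)

Section hilbert_space.
Variables (R : realType) (V : hilbertType R).
Implicit Types (u v w x y : V) (W : set V) (k e : R[i]).

Lemma innerC u v : inner u v = (inner v u)^*%R.
Proof. by rewrite hermC expr0 mul1r. Qed.

Lemma innerZl k u v : inner (k *: u) v = k * inner u v.
Proof. exact: linearZl_LR. Qed.

Lemma innerZr k u v : inner u (k *: v) = k^*%R * inner u v.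
Proof. exact: linearZr_LR. Qed.

Lemma innerDl u v w : inner (u + v) w = inner u w + inner v w.
Proof. exact: linearDl. Qed.

Lemma innerDr u v w : inner w (u + v) = inner w u + inner w v.
Proof. exact: linearDr. Qed.

Lemma innerBl u v w : inner (u - v) w = inner u w - inner v w.
Proof. exact: linearBl. Qed.

Lemma innerBr u v w : inner w (u - v) = inner w u - inner w v.
Proof. exact: linearBr. Qed.

(** Pythagoras for the projection of [u] onto the line of [v]. It yields both the Cauchy-Schwarz
    inequality and the fact that a shortest vector is orthogonal. *)
Lemma norm_residual u v : v != 0 ->
  `|u - (inner u v / `|v| ^+ 2) *: v| ^+ 2 =
  `|u| ^+ 2 - `|inner u v| ^+ 2 / `|v| ^+ 2.
Proof.
move=> v0; have n0 : `|v| ^+ 2 != 0 by rewrite expf_neq0// normr_eq0.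
rewrite -innerxx dnormB dnormZ /= linearZr_LR /= !innerxx.
rewrite normrM normfV normrX normr_id rmorphM /= fmorphV /= rmorphXn /=.
rewrite (geC0_conj (normr_ge0 v)).
have -> : (inner u v)^*%R / `|v| ^+ 2 * inner u v = `|inner u v| ^+ 2 / `|v| ^+ 2.
  by rewrite normCK mulrAC [inner u v * _]mulrC.
rewrite !rmorphM /= fmorphV /= !rmorphXn /= !geC0_conj//.
by field; rewrite normr_eq0.
Qed.

Lemma inner_norm_le u v : `|inner u v| <= `|u| * `|v|.
Proof.
have [->|v0] := eqVneq v 0; first by rewrite linear0r !normr0 mulr0.
rewrite -(@ler_pXn2r _ 2) ?nnegrE ?mulr_ge0// exprMn.
have n0 : 0 < `|v| ^+ 2 by rewrite exprn_gt0// normr_gt0.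
have : 0 <= `|u - (inner u v / `|v| ^+ 2) *: v| ^+ 2 by rewrite exprn_ge0.
by rewrite norm_residual// subr_ge0 ler_pdivrMr.
Qed.

Lemma orthogonal_of_minimal u w : (forall k, `|u| <= `|u - k *: w|) ->
  inner u w = 0.
Proof.
move=> umin; have [->|w0] := eqVneq w 0; first by rewrite linear0r.
have n0 : 0 < `|w| ^+ 2 by rewrite exprn_gt0// normr_gt0.
(* At the projection coefficient, minimality forces [|inner u w| ^+ 2 <= 0]. *)
have := umin (inner u w / `|w| ^+ 2).
rewrite -(@ler_pXn2r _ 2) ?nnegrE// norm_residual// lerBrDr gerDl.
rewrite pmulr_lle0 ?invr_gt0// real_exprn_even_le0//.
by rewrite normr_eq0 => /eqP.
Qed.

Lemma inner_eq0 u : (forall v, inner u v = 0) -> u = 0.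
Proof. by move=> /(_ u)/eqP; rewrite dnorm_eq0 => /eqP. Qed.

Lemma inner_injr u v : (forall w, inner w u = inner w v) -> u = v.
Proof.
move=> uv; apply/eqP; rewrite -subr_eq0; apply/eqP/inner_eq0 => w.
by rewrite innerC linearBr /= uv subrr rmorph0.
Qed.

Lemma inner_injl u v : (forall w, inner u w = inner v w) -> u = v.
Proof. by move=> uv; apply: inner_injr => w; rewrite innerC uv -innerC. Qed.

Lemma closed_approx W : closed W ->
  forall x, (forall e, 0 < e -> exists2 w, W w & `|x - w| < e) -> W x.
Proof.
move=> cW x xW; apply: cW => B /nbhs_ballP[e e0 Be].
have [w Ww xw] := xW e e0; exists w; split => //.
by apply: Be; rewrite -ball_normE.
Qed.

Lemma approx_closed W :
  (forall x, (forall e, 0 < e -> exists2 w, W w & `|x - w| < e) -> W x) ->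
  closed W.
Proof.
move=> WP x xW; apply: WP => e e0.
have [|w [Ww]] := xW (ball x e); first exact: nbhsx_ballx.
by rewrite -ball_normE; exists w.
Qed.

(** A bound [M] is only a complex number, and nothing constrains it when [b = 0]; [|M| + 1] is a
    positive real in every case and can be divided by. *)
Lemma bound_pos (M a b : R[i]) : 0 <= a -> 0 <= b -> a <= M * b ->
  a <= (`|M| + 1) * b.
Proof.
move=> a0 b0 aM; have Mb := ger0_real (le_trans a0 aM).
rewrite (le_trans aM)// (le_trans (real_ler_norm Mb))//.
by rewrite normrM (ger0_norm b0) ler_wpM2r// lerDl.
Qed.

Lemma closed_kernel (Y : normedZmodType R[i]) (f : V -> Y) (M : R[i]) :
  (forall u v, f (u - v) = f u - f v) -> (forall v, `|f v| <= M * `|v|) ->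
  closed [set v | f v = 0].
Proof.
move=> fB fM; apply: approx_closed => x xW /=.
apply/normr0_eq0/le_anti; rewrite normr_ge0 andbT.
apply/ler_addgt0Pr => e e0; rewrite add0r.
have M0 : 0 < `|M| + 1 by rewrite ltr_wpDl.
have [w /= fw xw] := xW (e / (`|M| + 1)) (divr_gt0 e0 M0).
have -> : f x = f (x - w) by rewrite fB fw subr0.
rewrite (le_trans (bound_pos _ _ (fM _)))//.
by rewrite mulrC -ler_pdivlMr// ltW.
Qed.

Lemma linear_subspaceP W : linear_subspace W <->
  W 0 /\ forall k u v, W u -> W v -> W (k *: u + v).
Proof.
split=> [[]|[W0 WP]].
  rewrite inE => W0 WP; split=> // k u v Wu Wv.
  by have := WP k u v; rewrite !inE; apply.
split; first by rewrite inE.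
by move=> k u v; rewrite !inE; exact: WP.
Qed.

Lemma kernel_subspace (Y : lmodType R[i]) (f : V -> Y) : linear f ->
  linear_subspace [set v | f v = 0].
Proof.
move=> lf; apply/linear_subspaceP; split; first exact: linear_fun0.
by move=> k u v /= fu fv; rewrite lf fu fv scaler0 addr0.
Qed.

(** [W] contains the span of [S], which meets every ball. This reduces identities between bounded
    maps to generators. *)
Lemma closed_subspace_full (S W : set V) : dense (linear_span S) ->
  closed W -> linear_subspace W -> S `<=` W -> W = setT.
Proof.
move=> dS cW sW SW; apply/seteqP; split=> // x _.
apply: closed_approx => // e e0.
have [||y [xy Sy]] := dS (ball x e).
- by exists x; exact: ballxx.
- exact: ball_open.
exists y; first by apply: Sy; split.
by move: xy; rewrite -ball_normE.
Qed.

Lemma parallelogram u v :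
  `|u + v| ^+ 2 + `|u - v| ^+ 2 = (`|u| ^+ 2 + `|v| ^+ 2) *+ 2.
Proof. by rewrite -!innerxx dnormD dnormB addrACA subrr addr0 mulr2n. Qed.

End hilbert_space.

(** * Orthogonal projection and reflection for a closed subspace *)

Section projection_theorem.
Variables (R : realType) (V : hilbertType R) (W : set V).
Hypotheses (cW : closed W) (sW : linear_subspace W).

(** Near-minimizers of the distance from [x] to [W] form a Cauchy filter; its limit is the nearest
    point, and minimality gives orthogonality. *)
Lemma projection_exists (x : V) :
  exists2 w, W w & forall w', W w' -> inner (x - w) w' = 0.
Proof.
have [W0 WP] := (linear_subspaceP W).1 sW.
(* Norms are valued in [R[i]], so squared distances are pulled back to [R], where the infimum
   exists. *)
pose E := [set r : R | exists2 w, W w & r%:C = `|x - w| ^+ 2].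
pose d := inf E.
have ReE (z : R[i]) : 0 <= z -> (complex.Re z)%:C = z.
  by move=> z0; rewrite RRe_real// ger0_real.
have lbE : lbound E 0.
  by move=> r [w _ rE]; rewrite -ler0c rE exprn_ge0.
have EP w : W w -> E (complex.Re (`|x - w| ^+ 2)).
  by move=> Ww; exists w => //; rewrite ReE// exprn_ge0.
have dE w : W w -> d%:C <= `|x - w| ^+ 2.
  move=> Ww; rewrite -[leRHS]ReE ?exprn_ge0// lecR.
  by apply: ge_inf; [exists 0|exact: EP].
pose F : set_system V := [set S | exists2 e : R[i], 0 < e &
  forall w, W w -> `|x - w| ^+ 2 < d%:C + e -> S w].
have FP S : F S -> exists2 w, W w & S w.
  move=> [e e0 Fe].
  have [||r [w Ww rE] rd] := @inf_adherent R E (complex.Re e).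
  - by rewrite -ltcR ReE// ltW.
  - by split; [exists (complex.Re (`|x - 0| ^+ 2)); exact: EP|exists 0].
  exists w => //; apply: Fe => //.
  by rewrite -rE -[e]ReE ?ltW// -rmorphD ltcR.
have FF : ProperFilter F.
  split.
    by move=> /FP[].
  split.
  - by exists 1.
  - move=> P Q [e e0 Pe] [e' e'0 Qe']; exists (Num.min e e').
      by rewrite /Num.min; case: ifP.
    have ee' : (e >=< e')%O by apply: real_comparable; exact: gtr0_real.
    move=> w Ww; rewrite -ltrBlDl comparable_lt_min// => /andP[? ?].
    by split; [apply: Pe|apply: Qe'] => //; rewrite -ltrBlDl.
  - by move=> P Q PQ [e e0 Pe]; exists e => // w Ww /Pe-/(_ Ww)/PQ.
have /cauchy_cvg : cauchy F.
  apply: cauchy_exP => e e0.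
  (* With [m] the midpoint of [w] and [w0], the parallelogram identity gives [|w0 - w| ^+ 2] as
     twice the sum of the two squared distances to [x], minus [4 * |x - m| ^+ 2]. Since [m] is in
     [W], an excess of [e ^+ 2 / 4] over [d] in each distance leaves less than [e ^+ 2]. *)
  have e20 : 0 < e ^+ 2 / 4 by rewrite divr_gt0 ?exprn_gt0.
  have /FP[w0 Ww0 [_ xw0]] :
      F [set w | W w /\ `|x - w| ^+ 2 < d%:C + e ^+ 2 / 4].
    by exists (e ^+ 2 / 4).
  exists w0; exists (e ^+ 2 / 4) => // w Ww xw.
  rewrite -ball_normE /ball_ /= -(@ltr_pXn2r _ 2) ?nnegrE// ?(ltW e0)//.
  have Wm : W (2^-1 *: (w + w0)).
    rewrite -[_ *: _]addr0; apply: (WP) => //.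
    by rewrite -[w]scale1r; exact: WP.
  have uv : `|(x - w) + (x - w0)| ^+ 2 = 4 * `|x - 2^-1 *: (w + w0)| ^+ 2.
    have -> : (x - w) + (x - w0) = 2 *: (x - 2^-1 *: (w + w0)).
      rewrite scalerBr scalerA divff ?pnatr_eq0// scale1r.
      by rewrite addrACA -opprD scaler_nat mulr2n.
    by rewrite normrZ exprMn ger0_norm// -natrX.
  have := parallelogram (x - w) (x - w0).
  rewrite uv [x - w - _]addrC opprB addrA subrK => /(canRL (addKr _)) ->.
  rewrite addrC ltrBlDr.
  have -> : e ^+ 2 + 4 * `|x - 2^-1 *: (w + w0)| ^+ 2 =
     (`|x - 2^-1 *: (w + w0)| ^+ 2 + e ^+ 2 / 4) *+ 2 *+ 2.
    by field.
  by rewrite ltrMn2r /= mulr2n ltrD// (lt_le_trans _ (lerD (dE _ Wm) (lexx _))).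
move=> /cvg_ex [y Fy].
have yW e : 0 < e -> F [set w | `|y - w| < e].
  move=> e0; have : F (ball y e) by apply: Fy; exact: nbhsx_ballx.
  by rewrite -ball_normE.
have Wy : W y.
  by apply: closed_approx => // e /yW /FP[w Ww yw]; exists w.
exists y => // w' Ww'; apply: orthogonal_of_minimal => k.
rewrite -addrA -opprD.
have /dE dy : W (y + k *: w') by rewrite addrC; exact: WP.
apply/ler_addgt0Pr => e e0.
have e20 : 0 < e / 2 by rewrite divr_gt0.
(* The excess is a square so that [d + (e / 2) ^+ 2] is at most the square of the competing distance
   plus [e / 2]. *)
have : F [set w | `|x - w| ^+ 2 < d%:C + (e / 2) ^+ 2 /\ `|y - w| < e / 2].
  apply: filterI; last exact: yW.
  by exists ((e / 2) ^+ 2) => //; rewrite exprn_gt0.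
move=> /FP[w Ww [xw yw]].
have : `|x - w| <= `|x - (y + k *: w')| + e / 2.
  rewrite -(@ler_pXn2r _ 2) ?nnegrE ?addr_ge0// ?ltW//.
  rewrite (lt_le_trans xw)//.
  rewrite sqrrD (le_trans (lerD dy (lexx _)))//.
  by rewrite lerD2r lerDl mulrn_wge0// mulr_ge0// ltW.
move=> xwe; rewrite (le_trans (ler_distD w _ _))//.
rewrite [e]splitr addrA lerD//.
by rewrite distrC ltW.
Qed.

Lemma projection_unique (x w1 w2 : V) : W w1 -> W w2 ->
  (forall w', W w' -> inner (x - w1) w' = 0) ->
  (forall w', W w' -> inner (x - w2) w' = 0) -> w1 = w2.
Proof.
move=> W1 W2 x1 x2; have [_ WP] := (linear_subspaceP W).1 sW.
have W12 : W (w2 - w1) by rewrite addrC -scaleN1r; exact: WP.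
apply/eqP; rewrite eq_sym -subr_eq0 -(@dnorm_eq0 _ _ (@inner R V)).
have {1}-> : w2 - w1 = (x - w1) - (x - w2) by rewrite opprB [RHS]addrC addrA subrK.
by rewrite innerBl x1// x2// subrr.
Qed.

(** With [P] the projection, [U = P - (1 - P)]. The cross terms vanish by orthogonality, so [U] is
    isometric, and [U] is its own inverse, hence onto. *)
Lemma reflection_exists : exists2 U : V -> V, unitary U & forall x w, W w ->
  (forall w', W w' -> inner (x - w) w' = 0) -> U x = w - (x - w).
Proof.
have /choice[P PP] x : exists w, W w /\ forall w', W w' -> inner (x - w) w' = 0.
  by have [w] := projection_exists x; exists w.
have PE x w : W w -> (forall w', W w' -> inner (x - w) w' = 0) -> P x = w.
  by move=> Ww; have [? ?] := PP x; exact: projection_unique.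
have [_ WP] := (linear_subspaceP W).1 sW.
pose U x := P x - (x - P x).
have lP : linear P.
  move=> k u v; have [Wu Pu] := PP u; have [Wv Pv] := PP v.
  apply: PE; first exact: WP.
  move=> w' Ww'; rewrite opprD addrACA -scalerBr.
  by rewrite innerDl innerZl Pu// Pv// mulr0 addr0.
have inner0 x y : inner (P x) (y - P y) = 0.
  have [Wx _] := PP x; have [_ Py] := PP y.
  by rewrite innerC Py// rmorph0.
exists U; last by move=> x w Ww xw; rewrite /U (PE x w).
split.
- move=> k u v; rewrite /U lP.
  have -> : k *: u + v - (k *: P u + P v) = k *: (u - P u) + (v - P v).
    by rewrite opprD addrACA -scalerBr.
  by rewrite opprD addrACA -scalerBr.
- move=> x y; rewrite /U innerBl [inner (P x) _]innerBr [inner (x - P x) (P y - _)]innerBr.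
  rewrite inner0 (innerC (x - P x) (P y)) inner0 rmorph0 !subr0 sub0r opprK.
  rewrite -[in RHS](subrK (P x) x) (innerDl (x - P x)) -[in RHS](subrK (P y) y).
  rewrite !(innerDr (y - P y) (P y)) inner0 (innerC (x - P x) (P y)) inner0.
  by rewrite rmorph0 add0r addr0 addrC.
- move=> y; exists (U y).
  have -> : U (U y) = P y - (U y - P y).
    rewrite {1}/U (PE (U y) (P y))//; first by have [] := PP y.
    move=> w' Ww'; rewrite /U addrAC subrr sub0r.
    have [_ Py] := PP y; by rewrite linearNl /= Py// oppr0.
  by rewrite /U [P y - _ - P y]addrAC subrr sub0r opprK addrC subrK.
Qed.

End projection_theorem.

(** * Riesz representation and adjoints *)

Section adjoint.
Variable R : realType.

(** For nonzero [f], take [u] with [f u] nonzero and orthogonal to the kernel; then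
    [v - (f v / f u) *: u] lies in the kernel, so pairing it with [u] computes [f v]. *)
Lemma riesz_representation (V : hilbertType R) (f : V -> R[i]) (M : R[i]) :
  (forall k u v, f (k *: u + v) = k * f u + f v) ->
  (forall v, `|f v| <= M * `|v|) ->
  exists z, forall v, f v = inner v z.
Proof.
move=> lf fM; have lf' : linear (f : V -> R[i]^o) by [].
have fB := linear_funB lf'; have fZ := linear_funZ lf'.
have cK := closed_kernel fB fM.
have sK := kernel_subspace lf'.
have [f0|] := pselect (forall v, f v = 0).
  by exists 0 => v; rewrite f0 linear0r.
move=> /existsNP[x /eqP fx].
have [w fw wK] := projection_exists cK sK x.
pose u := x - w.
have fu : f u = f x by rewrite fB fw subr0.
have u0 : inner u u != 0.
  rewrite dnorm_eq0; apply: contra_neq fx => u0.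
  by rewrite -fu u0 (linear_fun0 lf').
exists ((f u / inner u u)^*%R *: u) => v.
have /wK : f (v - (f v / f u) *: u) = 0.
  by rewrite fB fZ /= /GRing.scale /= divfK ?fu// subrr.
rewrite linearBr /= linearZr_LR /= -/u => /eqP; rewrite subr_eq0 => /eqP uv.
rewrite linearZr_LR /= conjCK (innerC v u) uv rmorphM /= conjCK -innerC.
by field; apply/andP; split; [rewrite fu|exact: u0].
Qed.

(** [B w] represents the functional pairing [A v] with [w]. Its bound comes from
    [|B w| ^+ 2 = inner (A (B w)) w] after cancelling [|B w|]. *)
Lemma adjoint_exists (V W : hilbertType R) (A : V -> W) (M : R[i]) :
  linear A -> (forall v, `|A v| <= M * `|v|) ->
  exists2 B : W -> V, linear B /\ (exists N, forall w, `|B w| <= N * `|w|)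
    & forall v w, inner (A v) w = inner v (B w).
Proof.
move=> lA AM.
have /choice[B BP] w : exists z, forall v, inner (A v) w = inner v z.
  apply: (@riesz_representation _ (fun v => inner (A v) w) (M * `|w|)).
    by move=> k u v; rewrite lA linearPl.
  move=> v; rewrite (le_trans (inner_norm_le _ _))// mulrAC ler_wpM2r//.
exists B => //; split.
  move=> k u v; apply: inner_injr => w.
  by rewrite -BP !(linearDr, linearZr_LR) /= !BP.
exists (`|M| + 1) => w; have [->|Bw] := eqVneq (B w) 0.
  by rewrite normr0 mulr_ge0// addr_ge0.
have B0 : 0 < `|B w| by rewrite normr_gt0.
have E : inner (A (B w)) w = `|B w| ^+ 2 by rewrite BP innerxx.
rewrite -(ler_pM2l B0) -expr2 -[leLHS]ger0_norm ?exprn_ge0// -E.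
rewrite (le_trans (inner_norm_le _ _))// mulrCA mulrA ler_wpM2r//.
rewrite mulrC [leRHS]mulrC.
exact: bound_pos.
Qed.

End adjoint.

(** * Operator square roots by iteration *)

Section square_root.
Variables (R : realType) (V : hilbertType R).

Lemma cvg_bounded_linear (W : hilbertType R) (T : V -> W) (M : R[i]) :
  linear T -> (forall v, `|T v| <= M * `|v|) ->
  forall (u : nat -> V) (l : V), u @ \oo --> l -> (T \o u) @ \oo --> T l.
Proof.
move=> lT TM u l /cvgrPdist_lt ul; apply/cvgrPdist_lt => e e0.
have M0 : 0 < `|M| + 1 by rewrite ltr_wpDl.
near=> n; rewrite /= -(linear_funB lT).
rewrite (le_lt_trans (bound_pos _ _ (TM _)))// mulrC -ltr_pdivlMr//.
by near: n; apply: ul; rewrite divr_gt0.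
Unshelve. all: by end_near. Qed.

Variable X : V -> V.
Hypotheses (lX : linear X) (X1 : forall v, `|X v| <= `|v|).

(* The limit [Z] of [sqrt_iter] satisfies [Z = (X + Z ^+ 2) / 2], that is,
   [(1 - Z) ^+ 2 = 1 - X]; the scalar iteration [sqrt_bound], which is the case
   [X = 1], dominates its increments. *)
Fixpoint sqrt_iter n v : V :=
  if n is m.+1 then 2^-1 *: (X v + sqrt_iter m (sqrt_iter m v)) else 0.

Fixpoint sqrt_bound n : R :=
  if n is m.+1 then 2^-1 * (1 + sqrt_bound m ^+ 2) else 0.

Let Y := sqrt_iter.
Let y := sqrt_bound.

Lemma sqrt_iter_linear n : linear (Y n).
Proof.
elim: n => [|n IH] k u v /=; first by rewrite scaler0 addr0.
by rewrite lX !IH addrACA scalerDr -(scalerDr k) !scalerA [_ * k]mulrC.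
Qed.

Lemma sqrt_bound_ge0 n : 0 <= y n.
Proof. by case: n => //= n; rewrite mulr_ge0 ?addr_ge0 ?sqr_ge0. Qed.

Lemma sqrt_bound_le1 n : y n <= 1.
Proof.
elim: n => //= n IH; rewrite ler_pdivrMl// mulr1 (_ : 2 = 1 + 1)//.
by rewrite lerD2l expr_le1// sqrt_bound_ge0.
Qed.

Lemma sqrt_bound_step n :
  y n.+2 - y n.+1 = 2^-1 * ((y n.+1 - y n) * (y n.+1 + y n)).
Proof. by rewrite /= -/y; field. Qed.

Lemma sqrt_bound_nondecreasing n : y n <= y n.+1.
Proof.
elim: n => [|n IH]; first exact: sqrt_bound_ge0 1%N.
by rewrite -subr_ge0 sqrt_bound_step !mulr_ge0 ?subr_ge0 ?addr_ge0 ?sqrt_bound_ge0.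
Qed.

Lemma sqrt_iter_norm n v : `|Y n v| <= (y n)%:C * `|v|.
Proof.
elim: n v => [|n IH] v /=; first by rewrite normr0 mul0r.
rewrite normrZ rmorphM/= fmorphV rmorph_nat normfV normr_nat -mulrA ler_pM2l//.
rewrite (le_trans (ler_normD _ _))// rmorphD rmorph1 mulrDl mul1r lerD//.
rewrite (le_trans (IH _))// rmorphXn/= expr2 -mulrA ler_wpM2l//.
by rewrite ler0c sqrt_bound_ge0.
Qed.

Lemma sqrt_iter_step n v : `|Y n.+1 v - Y n v| <= (y n.+1 - y n)%:C * `|v|.
Proof.
elim: n v => [|n IH] v; first by rewrite !subr0; exact: sqrt_iter_norm 1%N v.
(* A difference of squares split without using commutation, matching the factorization in
   [sqrt_bound_step] term by term. *)
have -> : Y n.+2 v - Y n.+1 v =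
    2^-1 *: ((Y n.+1 (Y n.+1 v) - Y n (Y n.+1 v)) + Y n (Y n.+1 v - Y n v)).
  transitivity (2^-1 *: (X v + Y n.+1 (Y n.+1 v)) - 2^-1 *: (X v + Y n (Y n v))).
    by [].
  rewrite (linear_funB (sqrt_iter_linear n)) addrA subrK.
  by rewrite -scalerBr opprD addrACA subrr add0r.
have : 0 <= (y n.+1 - y n)%:C by rewrite ler0c subr_ge0 sqrt_bound_nondecreasing.
rewrite sqrt_bound_step; move: IH; set d := y n.+1 - y n => IH d0.
have -> : (2^-1 * (d * (y n.+1 + y n)))%:C =
    2^-1 * (d%:C * (y n.+1)%:C + d%:C * (y n)%:C).
  by rewrite !(rmorphM, rmorphD) fmorphV rmorph_nat mulrDr.
rewrite normrZ normfV normr_nat -mulrA ler_pM2l// mulrDl -!mulrA.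
rewrite (le_trans (ler_normD _ _))// lerD//.
  by rewrite (le_trans (IH _))// ler_wpM2l//; exact: sqrt_iter_norm.
rewrite (le_trans (sqrt_iter_norm _ _))// mulrCA ler_wpM2l//.
by rewrite ler0c sqrt_bound_ge0.
Qed.

Lemma sqrt_iter_dist m n v : (m <= n)%N ->
  `|Y n v - Y m v| <= (y n - y m)%:C * `|v|.
Proof.
elim: n => [|n IH]; first by rewrite leqn0 => /eqP ->; rewrite !subrr normr0 mul0r.
rewrite leq_eqVlt => /predU1P[->|/IH mn]; first by rewrite !subrr normr0 mul0r.
rewrite (le_trans (ler_distD (Y n v) _ _))//.
rewrite (le_trans (lerD (sqrt_iter_step _ _) mn))//.
by rewrite -mulrDl -rmorphD/= addrA subrK.
Qed.

Lemma sqrt_iter_cvg v : cvgn (fun n => Y n v).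
Proof.
apply: cauchy_cvg; apply: cauchy_exP => e e0.
have v0 : 0 < `|v| + 1 by rewrite ltr_wpDl.
have d0 : 0 < e / (`|v| + 1) by rewrite divr_gt0.
have dE : (complex.Re (e / (`|v| + 1)))%:C = e / (`|v| + 1).
  by rewrite RRe_real// gtr0_real.
have uby : has_ubound (range y).
  by exists 1 => _ [n _ <-]; exact: sqrt_bound_le1.
(* From some index on, the monotone scalars stay this close to their supremum; the [+ 1] keeps the
   quotient meaningful for [v = 0]. *)
have [||_ [N _ <-] yN] := @sup_adherent R (range y) (complex.Re (e / (`|v| + 1))).
- by rewrite -ltcR dE.
- by split => //; exists (y 0%N), 0%N.
exists (Y N v); exists N => // n /= Nn; rewrite -ball_normE /ball_ /= distrC.
rewrite (le_lt_trans (sqrt_iter_dist _ Nn))//.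
rewrite (@le_lt_trans _ _ ((y n - y N)%:C * (`|v| + 1)))//.
  rewrite ler_wpM2l ?lerDl// ler0c subr_ge0.
  by move/nondecreasing_seqP : sqrt_bound_nondecreasing; apply.
rewrite -ltr_pdivlMr// -dE ltcR ltrBlDr.
apply: le_lt_trans (ub_le_sup uby _) _; first by exists n.
by rewrite addrC -ltrBlDr.
Qed.

(** [Z] is the pointwise limit of the iterates. Each iterate is a polynomial in [X], so whatever
    bounded map commutes with [X] commutes with [Z]; this later applies to [D] and to each
    [pi g]. *)
Lemma sqrt_iter_limit : exists Z : V -> V, [/\ linear Z,
  forall v, `|Z v| <= `|v|, forall v, Z v = 2^-1 *: (X v + Z (Z v)) &
  forall (T : V -> V) (M : R[i]), linear T -> (forall v, `|T v| <= M * `|v|) ->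
    (forall v, X (T v) = T (X v)) -> forall v, Z (T v) = T (Z v)].
Proof.
pose Z v := limn (fun n => Y n v); exists Z.
have ZP v : (fun n => Y n v) @ \oo --> Z v by exact: sqrt_iter_cvg.
have Y1 n v : `|Y n v| <= `|v|.
  rewrite (le_trans (sqrt_iter_norm _ _))// ler_piMl// lecR.
  exact: sqrt_bound_le1.
split.
- move=> k u v; apply: (@norm_cvg_unique _ _ _ _ _ _ (ZP _)).
  have -> : (fun n => Y n (k *: u + v)) = (fun n => k *: Y n u + Y n v).
    by apply/funext => n; exact: sqrt_iter_linear.
  by apply: cvgD => //; apply: cvgZ => //; exact: cvg_cst.
- move=> v; apply/ler_addgt0Pr => e e0.
  have /cvgrPdist_lt /(_ e e0) := ZP v => -[N _ /(_ N (leqnn N)) /= ZN].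
  rewrite -[Z v](subrK (Y N v)) (le_trans (ler_normD _ _))// addrC lerD//.
  exact: ltW.
- move=> v; apply: (@norm_cvg_unique _ _ _ _ _ _ (ZP _)).
  rewrite /= -cvg_shiftS.
  have -> : (fun n => Y n.+1 v) = (fun n => 2^-1 *: (X v + Y n (Y n v))) by [].
  apply: cvgZ; first exact: cvg_cst.
  apply: cvgD; first exact: cvg_cst.
  (* [Y n (Y n v)] is compared with [Z (Z v)] through [Y n (Z v)], each [Y n] being a
     contraction. *)
  apply/cvgrPdist_lt => e e0.
  have e20 : 0 < e / 2 by rewrite divr_gt0.
  have /cvgrPdist_lt/(_ _ e20) Z1 := ZP v.
  have /cvgrPdist_lt/(_ _ e20) Z2 := ZP (Z v).
  near=> n; rewrite (le_lt_trans (ler_distD (Y n (Z v)) _ _))//.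
  rewrite [ltRHS]splitr ltrD//; first by near: n.
  rewrite -(linear_funB (sqrt_iter_linear n)) (le_lt_trans (Y1 _ _))//.
  by near: n.
- move=> T M lT TM XT v; apply: (@norm_cvg_unique _ _ _ _ _ _ (ZP _)).
  have YT n w : Y n (T w) = T (Y n w).
    elim: n w => [|n IH] w /=; first by rewrite (linear_fun0 lT).
    by rewrite (linear_funZ lT) (linear_funD lT) XT !IH.
  have -> : (fun n => Y n (T v)) = T \o (fun n => Y n v).
    by apply/funext => n; exact: YT.
  exact: (cvg_bounded_linear lT TM).
Unshelve. all: by end_near. Qed.

End square_root.

(** * Schur's lemma *)

Section schur.
Variables (R : realType) (V : hilbertType R).

Lemma unitary_norm (U : V -> V) : unitary U -> forall v, `|U v| = `|v|.
Proof.
by move=> [_ iU _] v; apply/eqP; rewrite -(@eqrXn2 _ 2)// -!innerxx iU.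
Qed.

Variables (G : groupType) (pi : unitary_rep G V).
Hypothesis pi_irr : irreducible_rep pi.

Lemma irreducible_kernel (D : V -> V) (M : R[i]) :
  linear D -> (forall v, `|D v| <= M * `|v|) ->
  (forall g v, D (pi g v) = pi g (D v)) ->
  (forall v, D v = 0 -> v = 0) \/ (forall v, D v = 0).
Proof.
move=> lD DM Dpi.
have [||g w /= Dw|E|E] := pi_irr (W := [set v | D v = 0]).
- exact: closed_kernel (linear_funB lD) DM.
- exact: kernel_subspace.
- have [lpi _ _] := rep_unitary pi g.
  by rewrite Dpi Dw (linear_fun0 lpi).
- by left => v Dv; have : [set v | D v = 0] v by []; rewrite E.
- by right => v; have : [set v | D v = 0] v by rewrite E.
Qed.

(* [D ^+ 2] has a square root [S], which commutes with [D], so the range of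
   [S + D] lies in the kernel of [S - D]; by irreducibility [S = D] or
   [S = - D]. *)
Lemma irreducible_contraction_eq0 (D : V -> V) (v0 : V) :
  linear D -> (forall v, `|D v| <= `|v|) ->
  (forall u v, inner (D u) v = inner u (D v)) ->
  (forall g v, D (pi g v) = pi g (D v)) ->
  v0 != 0 -> inner (D v0) v0 = 0 -> forall v, D v = 0.
Proof.
move=> lD D1 sD Dpi v00 Dv0.
pose X v := v - D (D v).
have lX : linear X.
  by move=> k u v; rewrite /X !lD opprD addrACA scalerBr.
(* Self-adjointness expands [|X v| ^+ 2] to [|v| ^+ 2] minus twice [|D v| ^+ 2] plus
   [|D (D v)| ^+ 2], and [D] is a contraction. *)
have X1 v : `|X v| <= `|v|.
  have vDD : inner v (D (D v)) = `|D v| ^+ 2 by rewrite -sD innerxx.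
  rewrite -(@ler_pXn2r _ 2) ?nnegrE// -innerxx dnormB /= vDD !innerxx.
  rewrite geC0_conj ?exprn_ge0// -addrA gerDl subr_le0.
  by rewrite (@le_trans _ _ (`|D v| ^+ 2)) ?lerDl ?exprn_ge0// ler_pXn2r ?nnegrE.
have [Y [lY Y1 YE Yc]] := sqrt_iter_limit lX X1.
pose S v := v - Y v.
have lS : linear S.
  by move=> k u v; rewrite /S !lY opprD addrACA scalerBr.
have SS v : S (S v) = D (D v).
  rewrite /S (linear_funB lY).
  have : Y v + Y v = X v + Y (Y v).
    by rewrite {1 2}YE -scalerDl -[2^-1]mul1r -splitr scale1r.
  move=> YY; rewrite opprB addrACA -opprD YY opprD addrACA subrr addr0.
  by rewrite /X subKr.
have SD v : S (D v) = D (S v).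
  rewrite /S (linear_funB lD) (Yc D 1)// => u; first by rewrite mul1r.
  by rewrite /X (linear_funB lD).
have Spi g v : S (pi g v) = pi g (S v).
  have [lpi _ _] := rep_unitary pi g.
  rewrite /S (linear_funB lpi) (Yc (pi g) 1)// => u.
    by rewrite mul1r unitary_norm//; exact: rep_unitary.
  by rewrite /X (linear_funB lpi) !Dpi.
have SDE : (forall v, S v = D v) \/ (forall v, S v = - D v).
  have lSD : linear (fun v => S v - D v).
    by move=> k u v /=; rewrite lS lD opprD addrACA -scalerBr.
  have bSD v : `|S v - D v| <= (1 + 1 + 1) * `|v|.
    rewrite (le_trans (ler_normB _ _))// !mulrDl mul1r lerD//.
    by rewrite (le_trans (ler_normB _ _))// lerD.
  have [|E|E] := irreducible_kernel lSD bSD.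
  - move=> g v; have [lpi _ _] := rep_unitary pi g.
    by rewrite Spi Dpi -(linear_funB lpi).
  - right=> v; apply/eqP; rewrite -addr_eq0; apply/eqP/E.
    by rewrite (linear_funD lS) (linear_funD lD) SS SD [D (D v) + _]addrC subrr.
  - by left=> v; apply/eqP; rewrite -subr_eq0 E.
have Sv0 : inner (S v0) v0 = 0.
  by case: SDE => ->; rewrite ?linearNl /= Dv0 ?oppr0.
have Yv0 : inner (Y v0) v0 = `|v0| ^+ 2.
  by move: Sv0; rewrite /S linearBl /= innerxx => /eqP; rewrite subr_eq0 => /eqP.
(* Equality in Cauchy-Schwarz for the contraction [Y]: here [|S v0| ^+ 2] equals
   [|Y v0| ^+ 2 - |v0| ^+ 2], which is at most 0. *)
have {}Sv0 : S v0 = 0.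
  apply/eqP; rewrite -normr_eq0 -sqrf_eq0; apply/eqP/le_anti.
  rewrite exprn_ge0// andbT -innerxx dnormB /= (innerC v0 (Y v0)) Yv0 conjCK !innerxx.
  rewrite geC0_conj ?exprn_ge0// opprD addrACA subrr add0r subr_le0.
  by rewrite ler_pXn2r ?nnegrE.
have {}Dv0 : D v0 = 0.
  by case: SDE => E; move: (E v0); rewrite Sv0 => // /esym/eqP; rewrite oppr_eq0 => /eqP.
have D1' v : `|D v| <= 1 * `|v| by rewrite mul1r.
have [/(_ _ Dv0) v0E|//] := irreducible_kernel lD D1' Dpi.
by rewrite v0E eqxx in v00.
Qed.

Lemma irreducible_selfadjoint_scalar (B : V -> V) (M : R[i]) :
  linear B -> (forall v, `|B v| <= M * `|v|) ->
  (forall u v, inner (B u) v = inner u (B v)) ->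
  (forall g v, B (pi g v) = pi g (B v)) ->
  exists c : R[i], forall v, B v = c *: v.
Proof.
move=> lB BM sB Bpi.
have [V0|] := pselect (forall v : V, v = 0).
  by exists 0 => v; rewrite [B v]V0 [RHS]V0.
move=> /existsNP[v0 /eqP v00].
have n0 : inner v0 v0 != 0 by rewrite dnorm_eq0.
(* The Rayleigh quotient, real because [B] is self-adjoint, makes [inner (D v0) v0] vanish; dividing
   by [N] makes [D] a contraction. *)
pose c := inner (B v0) v0 / inner v0 v0.
have cR : (c^*)%R = c.
  by rewrite /c rmorphM /= fmorphV /= -!innerC -sB.
pose N := (`|M| + 1) + `|c|.
have N0 : 0 < N by rewrite ltr_wpDr// ltr_wpDl.
pose D v := N^-1 *: (B v - c *: v).
exists c => v; apply/eqP; rewrite -subr_eq0.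
suff /eqP : D v = 0 by rewrite scaler_eq0 invr_eq0 gt_eqF.
apply: (@irreducible_contraction_eq0 D v0) => //.
- move=> k u w; rewrite /D lB (scalerDr c) [c *: (k *: u)]scalerA [c * k]mulrC.
  rewrite -[(k * c) *: u]scalerA opprD addrACA -scalerBr scalerDr.
  by rewrite !scalerA [_ * k]mulrC.
- move=> u; rewrite normrZ normfV (gtr0_norm N0) ler_pdivrMl//.
  rewrite (le_trans (ler_normB _ _))// mulrDl normrZ lerD//.
  exact: bound_pos.
- move=> u w; rewrite /D !(innerZl, innerZr) innerBl innerBr innerZl innerZr cR sB.
  congr (_ * _).
  by rewrite geC0_conj// invr_ge0 ltW.
- move=> g u; have [lpi _ _] := rep_unitary pi g.
  by rewrite /D Bpi (linear_funZ lpi) (linear_funB lpi) (linear_funZ lpi).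
- by rewrite /D innerZl innerBl innerZl divfK// subrr mulr0.
Qed.

Theorem schur (B : V -> V) (M : R[i]) :
  linear B -> (forall v, `|B v| <= M * `|v|) ->
  (forall g v, B (pi g v) = pi g (B v)) ->
  exists c : R[i], forall v, B v = c *: v.
Proof.
move=> lB BM Bpi.
have [B' [lB' [M' BM']] B'P] := adjoint_exists lB BM.
have B'pi g v : B' (pi g v) = pi g (B' v).
  have [lpi ipi spi] := rep_unitary pi g.
  apply: inner_injr => u; have [w <-] := spi u.
  by rewrite -B'P Bpi !ipi B'P.
have BB' u v : inner (B' u) v = inner u (B v).
  by rewrite innerC -B'P -innerC.
(* Both are self-adjoint, and [B] is recovered as half of [P - 'i Q]. *)
pose P v := B v + B' v; pose Q v := 'i *: (B v - B' v).
have [c1 c1P] : exists c : R[i], forall v, P v = c *: v.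
  apply: (@irreducible_selfadjoint_scalar _ ((`|M| + 1) + (`|M'| + 1))).
  - by move=> k u v; rewrite /P lB lB' addrACA scalerDr.
  - move=> v; rewrite (le_trans (ler_normD _ _))// mulrDl lerD//;
    exact: bound_pos.
  - by move=> u v; rewrite linearDl linearDr /= B'P BB' addrC.
  - move=> g v; have [lpi _ _] := rep_unitary pi g.
    by rewrite /P Bpi B'pi (linear_funD lpi).
have [c2 c2P] : exists c : R[i], forall v, Q v = c *: v.
  apply: (@irreducible_selfadjoint_scalar _ ((`|M| + 1) + (`|M'| + 1))).
  - move=> k u v; rewrite /Q lB lB' opprD addrACA -scalerBr scalerDr !scalerA.
    by rewrite mulrC.
  - move=> v; rewrite normrZ normCi mul1r (le_trans (ler_normB _ _))// mulrDl lerD//;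
    exact: bound_pos.
  - move=> u v; rewrite /Q innerZl innerZr innerBl innerBr B'P BB'.
    by rewrite conjCi mulNr -mulrN opprB.
  - move=> g v; have [lpi _ _] := rep_unitary pi g.
    by rewrite /Q Bpi B'pi (linear_funZ lpi) (linear_funB lpi).
exists (2^-1 * (c1 - 'i * c2)) => v.
rewrite -scalerA scalerBl -c1P -scalerA -c2P /P /Q scalerA -expr2 sqrCi scaleN1r.
rewrite opprK addrACA subrr addr0 -mulr2n -[B v *+ 2]scaler_nat scalerA mulVf ?scale1r//.
Qed.

End schur.

(** * The commutant of the tensor representation *)

Section tensor.
Variables (R : realType) (V : hilbertType R) (T : hilbert_tensor V V).

Lemma tensor_norm (v w : V) : `|tensor T v w| = `|v| * `|w|.
Proof.
apply/eqP; rewrite -(@eqrXn2 _ 2)// ?mulr_ge0// exprMn -!innerxx.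
by rewrite inner_tensor.
Qed.

Lemma eq_on_tensors (f g : T -> T) (M N : R[i]) : linear f -> linear g ->
  (forall t, `|f t| <= M * `|t|) -> (forall t, `|g t| <= N * `|t|) ->
  (forall v w, f (tensor T v w) = g (tensor T v w)) -> f =1 g.
Proof.
move=> lf lg fM gN fg t; apply/eqP; rewrite -subr_eq0; apply/eqP.
have lh : linear (fun t => f t - g t).
  by move=> k u v; rewrite lf lg opprD addrACA -scalerBr.
have hM u : `|f u - g u| <= ((`|M| + 1) + (`|N| + 1)) * `|u|.
  by rewrite (le_trans (ler_normB _ _))// mulrDl lerD// bound_pos.
suff : [set u | f u - g u = 0] t by [].
rewrite (closed_subspace_full (@dense_tensor _ _ _ T)
  (closed_kernel (linear_funB lh) hM) (kernel_subspace lh))//.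
by move=> _ [[v w] _ <-]; rewrite /= fg subrr.
Qed.

Lemma eq_inner_tensors (x y : T) :
  (forall v w, inner x (tensor T v w) = inner y (tensor T v w)) -> x = y.
Proof.
move=> xy; apply: inner_injl => t; apply/eqP; rewrite -subr_eq0 -innerBl.
rewrite innerC conjC_eq0; apply/eqP.
have lh : linear ((fun t => inner t (x - y)) : T -> R[i]^o).
  by move=> k u v; rewrite innerDl innerZl.
have hM (u : T) : `|inner u (x - y)| <= `|x - y| * `|u|.
  by rewrite mulrC inner_norm_le.
suff : [set u : T | inner u (x - y) = 0] t by [].
rewrite (closed_subspace_full (@dense_tensor _ _ _ T)
  (closed_kernel (linear_funB lh) hM) (kernel_subspace lh))//.
move=> _ [[v w] _ <-] /=; apply/eqP; rewrite -conjC_eq0 -innerC innerBl xy.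
by rewrite subrr.
Qed.

Lemma unitary_bounded (X : hilbertType R) (U : X -> X) : unitary U ->
  bounded_operator U.
Proof.
by move=> uU; split; [case: uU|exists 1 => v; rewrite mul1r unitary_norm].
Qed.

Variables (G : groupType) (pi : unitary_rep G V).

(** [pi 1] is idempotent and isometric, hence injective. *)
Lemma rep1 v : pi 1%g v = v.
Proof.
have uU := rep_unitary pi 1%g; have [lU _ _] := uU.
apply/eqP; rewrite -subr_eq0 -normr_eq0 -(unitary_norm uU) (linear_funB lU).
by rewrite normr_eq0 -[pi 1%g (pi 1%g v)]/((pi 1%g \o pi 1%g) v) -repM mulg1 subrr.
Qed.

Lemma tensor_repE g h v w :
  tensor_rep T pi (g, h) (tensor T v w) = tensor T (pi g v) (pi h w).
Proof.
by have [_] := tensor_unitaryP T (rep_unitary pi g) (rep_unitary pi h); exact.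
Qed.

Lemma tensor_rep_unitary gh : unitary (tensor_rep T pi gh).
Proof.
by case: (tensor_unitaryP T (rep_unitary pi gh.1) (rep_unitary pi gh.2)).
Qed.

Lemma flip_tensor_rep g h t :
  flip T (tensor_rep T pi (g, h) t) = tensor_rep T pi (h, g) (flip T t).
Proof.
have [uF _ FE] := flipP T.
have [lF _ _] := uF; have [l1 _ _] := tensor_rep_unitary (g, h).
have [l2 _ _] := tensor_rep_unitary (h, g).
apply: (@eq_on_tensors (flip T \o tensor_rep T pi (g, h))
  (tensor_rep T pi (h, g) \o flip T) 1 1) => /=.
- by move=> k u v /=; rewrite l1 lF.
- by move=> k u v /=; rewrite lF l2.
- by move=> u; rewrite mul1r (unitary_norm uF) (unitary_norm (tensor_rep_unitary _)).
- by move=> u; rewrite mul1r (unitary_norm (tensor_rep_unitary _)) (unitary_norm uF).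
- by move=> v w; rewrite tensor_repE !FE tensor_repE.
Qed.

Hypothesis pi_irr : irreducible_rep pi.

Lemma commutant_tensor_slice (A : T -> T) : bounded_operator A ->
  (forall gh t, A (tensor_rep T pi gh t) = tensor_rep T pi gh (A t)) ->
  forall w w', exists c : R[i], forall v v',
    inner (A (tensor T v w)) (tensor T v' w') = c * inner v v'.
Proof.
move=> [lA [M AM]] Api w w'.
have lL u : linear (fun v => tensor T v u) by move=> k v v'; rewrite linearPl.
have bL u v : `|tensor T v u| <= `|u| * `|v| by rewrite tensor_norm mulrC.
(* [L] contracts the second factor against [w'], turning the sesquilinear form into an operator [B]
   on [V]. *)
have [L [lL' [N LN]] LP] := adjoint_exists (lL w') (bL w').
pose B v := L (A (tensor T v w)).
have BP v v' : inner (B v) v' = inner (A (tensor T v w)) (tensor T v' w').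
  by rewrite innerC -LP -innerC.
have [c Bc] : exists c : R[i], forall v, B v = c *: v.
  apply: (@schur _ _ _ _ pi_irr B ((`|N| + 1) * ((`|M| + 1) * `|w|))).
  - by move=> k u v; rewrite /B lL lA lL'.
  - move=> v; rewrite (le_trans (bound_pos _ _ (LN _)))// -mulrA ler_wpM2l ?addr_ge0//.
    by rewrite (le_trans (bound_pos _ _ (AM _)))// -mulrA ler_wpM2l ?addr_ge0//.
  - move=> g v; apply: inner_injl => v'; rewrite BP.
    have [_ ipi spi] := rep_unitary pi g; have [u <-] := spi v'.
    (* Inserting [pi 1] on the second factor makes [pi g] on the first an instance of the tensor
       representation, with which [A] commutes. *)
    rewrite ipi BP -[w in LHS]rep1 -[w' in LHS]rep1 -!tensor_repE Api.
    by have [_ -> _] := tensor_rep_unitary (g, 1%g).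
by exists c => v v'; rewrite -BP Bc innerZl.
Qed.

Lemma commutant_tensor_scalar (A : T -> T) :
  commutant (range (tensor_rep T pi)) A ->
  exists c : R[i], forall t, A t = c *: t.
Proof.
move=> [bA Acomm]; have [lA [M AM]] := bA.
have Api gh t : A (tensor_rep T pi gh t) = tensor_rep T pi gh (A t).
  by apply: (congr1 (@^~ t) (Acomm (tensor_rep T pi gh) _)); exists gh.
have [uF FK FE] := flipP T; have [lF iF _] := uF.
pose A' t := flip T (A (flip T t)).
have bA' : bounded_operator A'.
  split; first by move=> k u v; rewrite /A' lF lA lF.
  exists M => t; rewrite /A' (unitary_norm uF) (le_trans (AM _))//.
  by rewrite (unitary_norm uF).
have A'pi gh t : A' (tensor_rep T pi gh t) = tensor_rep T pi gh (A' t).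
  by case: gh => g h; rewrite /A' flip_tensor_rep Api flip_tensor_rep.
have /choice[lam lamP] : forall ww, exists c : R[i], forall v v',
    inner (A (tensor T v ww.1)) (tensor T v' ww.2) = c * inner v v'.
  by move=> [w w']; exact: commutant_tensor_slice.
have A'E v v' w w' : inner (A (tensor T v w)) (tensor T v' w') =
    inner (A' (tensor T w v)) (tensor T w' v').
  by rewrite /A' FE -(FE v' w') iF.
have [V0|/existsNP[v0 /eqP v00]] := pselect (forall v : V, v = 0).
  exists 0 => t; apply: eq_inner_tensors => v w.
  by rewrite (V0 v) linear0l !linear0r.
have n0 : inner v0 v0 != 0 by rewrite (@dnorm_eq0 _ _ (@inner R V)).
have [mu muP] := commutant_tensor_slice bA' A'pi v0 v0.
have lamE w w' : lam (w, w') = mu / inner v0 v0 * inner w w'.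
  (* At [v = v' = v0] the same matrix coefficient is computed by slicing in either factor, which
     determines [lam]. *)
  apply: (mulIf n0); rewrite -(lamP (w, w')) A'E muP.
  by rewrite mulrAC divfK.
exists (mu / inner v0 v0) => t; move: t.
apply: (@eq_on_tensors A ( *:%R (mu / inner v0 v0)) M `|mu / inner v0 v0|) => //.
- by move=> k u v; rewrite scalerDr !scalerA mulrC.
- by move=> t; rewrite normrZ.
move=> v w; apply: eq_inner_tensors => v' w'.
by rewrite (lamP (w, w')) lamE innerZl inner_tensor -mulrA [inner w w' * _]mulrC.
Qed.

End tensor.

(** * The flip criterion for irreducibility *)

Section flip_and_irreducibility.
Variables (R : realType) (G : groupType) (V : hilbertType R).
Variables (pi : unitary_rep G V) (T : hilbert_tensor V V).

Lemma flip_von_neumann : irreducible_rep pi ->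
  von_neumann (range (tensor_rep T pi)) (flip T).
Proof.
move=> pi_irr; have [uF _ _] := flipP T; have [lF _ _] := uF.
split; first exact: unitary_bounded.
move=> A /(commutant_tensor_scalar pi_irr)[c Ac].
by apply/funext => t /=; rewrite !Ac (linear_funZ lF).
Qed.

Lemma von_neumann_flip_irreducible :
  von_neumann (range (tensor_rep T pi)) (flip T) -> irreducible_rep pi.
Proof.
move=> [_ Fcomm] W cW sW Wpi.
have [W0 WP] := (linear_subspaceP W).1 sW.
have [U uU UE] := reflection_exists cW sW.
(* [pi g] carries the orthogonal decomposition of [v] along [W] to that of [pi g v]; invariance
   under the inverse of [g] preserves the orthogonal part. *)
have Upi g v : U (pi g v) = pi g (U v).
  have [lpi ipi spi] := rep_unitary pi g.
  have [w Ww vw] := projection_exists cW sW v.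
  rewrite (UE v w)// !(linear_funB lpi) -(linear_funB lpi).
  rewrite (UE (pi g v) (pi g w)) ?(linear_funB lpi)//; first exact: Wpi.
  move=> w' Ww'; rewrite -(linear_funB lpi).
  have <- : pi g (pi g^-1%g w') = w'.
    by rewrite -[LHS]/((pi g \o pi g^-1%g) w') -repM mulgV rep1.
  by rewrite ipi vw//; exact: Wpi.
have uid : unitary (@idfun V) by split => // y; exists y.
have [uUT UTE] := tensor_unitaryP T uU uid.
have [lUT _ _] := uUT.
have /Fcomm FU : commutant (range (tensor_rep T pi)) (tensor_unitary T uU uid).
  split; first exact: unitary_bounded.
  move=> _ [[g h] _ <-]; apply/funext.
  have uR := tensor_rep_unitary T pi (g, h); have [lR _ _] := uR.
  apply: (@eq_on_tensors _ _ _ _ _ 1 1) => /=.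
  - by move=> k u v /=; rewrite lR lUT.
  - by move=> k u v /=; rewrite lUT lR.
  - by move=> u; rewrite mul1r (unitary_norm uUT) (unitary_norm uR).
  - by move=> u; rewrite mul1r (unitary_norm uR) (unitary_norm uUT).
  - by move=> v w; rewrite tensor_repE !UTE tensor_repE Upi.
have [_ _ FE] := flipP T.
have [WT|/existsNP[x Wx]] := pselect (forall x, W x).
  by right; apply/seteqP; split.
left; apply/seteqP; split=> [v Wv /=|_ ->//].
have [w Ww xw] := projection_exists cW sW x.
have xw0 : x - w != 0.
  by rewrite subr_eq0; apply/eqP => xE; apply: Wx; rewrite xE.
have Uv : U v = v.
  by rewrite (UE v v)// ?subrr ?subr0// => w' _; rewrite linear0l.
have Uxw : U (x - w) = - (x - w).
  by rewrite (UE (x - w) 0)// ?subr0 ?sub0r// => w' /xw; rewrite subr0.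
(* [U] fixes [v] and negates the nonzero vector [x - w], so the two sides are opposite values of
   [tensor T (x - w) v]; this tensor is zero, and its norm is a product. *)
have := congr1 (@^~ (tensor T v (x - w))) FU.
rewrite /= UTE !FE UTE Uv Uxw linearNl => /eqP.
rewrite -addr_eq0 -mulr2n -scaler_nat scaler_eq0 pnatr_eq0/= -normr_eq0.
by rewrite tensor_norm mulf_eq0 !normr_eq0 (negbTE xw0) => /eqP.
Qed.

End flip_and_irreducibility.

Theorem mainTheorem2 (R : realType) (G : topologicalGroupType)
    (H : hilbertType R) (pi : unitary_rep G H) (T : hilbert_tensor H H) :
  locally_compact [set: G] -> hausdorff_space G -> strongly_continuous pi ->
  irreducible_rep pi <-> von_neumann (range (tensor_rep T pi)) (flip T).
Proof.
move=> _ _ _; split; first exact: flip_von_neumann.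
exact: von_neumann_flip_irreducible.
Qed.
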